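(* Let $\mu\ge 1$, let $p,q$ be coprime positive integers, let $L=T(\mu p,\mu q)\subset S^3$ be the $\mu$-component torus link with link group $G(L)$, and let $n\ge 1$. For an irreducible representation $\rho:G(L)\to\mathrm{SL}(2,\mathbb{C})$ let $\rho_n=\sigma_n\circ\rho:G(L)\to\mathrm{SL}(n,\mathbb{C})$. Then every coefficient of the twisted Alexander polynomial $\Delta_{L,\rho_n}(t_1,\ldots,t_\mu)$ is locally constant on the irreducible character variety $\mathcal{X}(\mu p,\mu q)$.
   Context: Link group. $G(L)=\pi_1(S^3\setminus \mathrm{int}\,N(L))$, where $N(L)$ is a closed tubular neighbourhood of $L$. For $L=T(\mu p,\mu q)$ it has the presentation $$G(L)=\langle m_1,\ldots,m_\mu,x,y,\ell\mid m_\mu m_{\mu-1}\cdots m_1=x^ry^s,\ [\ell,m_i]=1\ (1\le i\le\mu),\ \ell=x^p=y^q\rangle ,$$ where $r,s$ are integers with $ps+qr=1$, $x,y$ represent the cores of the two solid tori of the genus one Heegaard splitting of $S^3$ given by the standard torus containing $L$, $\ell$ represents a parallel of the torus knot $T(p,q)$ on that torus, and $m_i$ is a meridian of the $i$-th component. Eliminating $m_\mu$ and $\ell$ it reduces to $$G(L)=\langle m_1,\ldots,m_{\mu-1},x,y\mid [x^p,m_i]=1\ (1\le i\le \mu-1),\ x^p=y^q\rangle .$$ The abelianization $\alpha_L:G(L)\to H_1(S^3\setminus \mathrm{int}\,N(L);\mathbb{Z})\cong\langle t_1\rangle\oplus\cdots\oplus\langle t_\mu\rangle\cong\mathbb{Z}^{\mu}$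 (written multiplicatively) is $\alpha_L(m_i)=t_i$, $\alpha_L(x)=t^q$, $\alpha_L(y)=t^p$, with $t=t_1\cdots t_\mu$. The representation $\sigma_n$. Let $V_n=\mathrm{span}_{\mathbb{C}}\langle z_1^{n-1},z_1^{n-2}z_2,\ldots,z_2^{n-1}\rangle$ be the space of homogeneous polynomials of degree $n-1$ on $\mathbb{C}^2$. $P\in\mathrm{SL}(2,\mathbb{C})$ acts by $(P\cdot f)(z_1,z_2)=f\big(P^{-1}\begin{pmatrix} z_1 \\ z_2 \end{pmatrix}\big)$; this defines the $n$-dimensional irreducible representation $\sigma_n:\mathrm{SL}(2,\mathbb{C})\to \mathrm{GL}(V_n)$, whose image lies in $\mathrm{SL}(V_n)\cong\mathrm{SL}(n,\mathbb{C})$. Twisted Alexander polynomial (Wada). Let $G(L)=\langle x_1,\ldots,x_l\mid r_1,\ldots,r_{l-1}\rangle$ be a presentation with one fewer relator than generators (e.g. a Wirtinger presentation or the reduced one above), $F_l$ the free group on $x_1,\dots,x_l$, and $\varphi:G(L)\to\mathrm{SL}(n,\mathbb{C})$ a representation. Let $\Phi:\mathbb{Z}[F_l]\to M(n,\mathbb{C}[t_1^{\pm1},\ldots,t_\mu^{\pm1}])$ be the composition of the projection $\mathbb{Z}[F_l]\to\mathbb{Z}[G(L)]$ with the ring homomorphism determined by $g\mapsto \alpha_L(g)\varphi(g)$. Let $A$ be the $(l-1)\times l$ matrix whose $(i,j)$ entry is the $n\times n$ block $\Phi(\partial r_i/\partial x_j)$ (free differential), and let $A_j$ be $A$ with its $j$-th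 block column removed, regarded as an $n(l-1)\times n(l-1)$ matrix. Then $\Delta_{L,\varphi}(t_1,\ldots,t_\mu)=\det A_j/\det\Phi(x_j-1)$ (for any $j$ with nonzero denominator), a rational function independent of the choice of presentation and of $\varphi$ within its conjugacy class, and well defined up to multiplication by $t_1^{nk_1}\cdots t_\mu^{nk_\mu}$, $k_j\in\mathbb{Z}$ (and up to sign if $n$ is odd). Character variety. $\rho$ is irreducible if $\mathbb{C}^2$ has no nontrivial proper $\rho(G(L))$-invariant subspace. $\mathcal{R}(\mu p,\mu q)$ is the set of irreducible representations $G(L)\to\mathrm{SL}(2,\mathbb{C})$, topologized as a subspace of $\mathrm{SL}(2,\mathbb{C})^{\mu+1}$ via the images of $m_1,\dots,m_{\mu-1},x,y$, and $\mathcal{X}(\mu p,\mu q)$ is its quotient by conjugation by $\mathrm{SL}(2,\mathbb{C})$. Local constancy of the coefficients means that every point of $\mathcal{X}(\mu p,\mu q)$ has a neighbourhood on which $\Delta_{L,\rho_n}$, as a class modulo the stated indeterminacy, does not vary. *)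

(* Defs.v *)
From HB Require Import structures.
From mathcomp Require Import all_boot all_order all_algebra.
From mathcomp Require Import all_classical all_reals all_analysis.
From mathcomp Require Import complex.
(* The notations of [mpoly] clash with those of the analysis library. *)
From mathcomp Require Import -(notations) mpoly.

Set Implicit Arguments.
Unset Strict Implicit.
Unset Printing Implicit Defensive.

Import Order.TTheory GRing.Theory Num.Theory.
Import numFieldNormedType.Exports.

Local Open Scope classical_set_scope.
Local Open Scope ring_scope.
Local Open Scope quotient_scope.

(* Words in x_0, ..., x_(l-1) and their inverses, not necessarily reduced:
   (i, false) stands for x_i and (i, true) for x_i^-1. *)
Definition letter (l : nat) : Type := ('I_l * bool)%type.
Definition word (l : nat) : Type := seq (letter l).

Definition letter_inv l (a : letter l) : letter l := (a.1, ~~ a.2).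
Definition word_inv l (w : word l) : word l := rev (map (@letter_inv l) w).
Definition word_gen l (i : 'I_l) : word l := [:: (i, false)].
Definition word_pow l (w : word l) (m : nat) : word l := iter m (cat w) [::].
Definition word_comm l (u v : word l) : word l :=
  u ++ v ++ word_inv u ++ word_inv v.

Section PresentedGroup.
Variables (l k : nat) (r : 'I_k -> word l).

Inductive pres_eq : word l -> word l -> Prop :=
| PresRefl u : pres_eq u u
| PresSym u v : pres_eq u v -> pres_eq v u
| PresTrans u v w : pres_eq u v -> pres_eq v w -> pres_eq u w
| PresCancel u a v : pres_eq (u ++ a :: letter_inv a :: v) (u ++ v)
| PresRel u i v : pres_eq (u ++ r i ++ v) (u ++ v).

Definition pres_eqb (u v : word l) : bool := `[< pres_eq u v >].

Lemma pres_eqb_equiv : equiv_class_of pres_eqb.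
Proof.
split=> [u|u v|v u w].
- by apply/asboolP/PresRefl.
- by apply/asboolP/asboolP=> h; apply: PresSym.
- by move=> /asboolP h1 /asboolP h2; apply/asboolP/(PresTrans h1).
Qed.

Canonical pres_equiv := EquivRelPack pres_eqb_equiv.

Definition pres_group : Type := {eq_quot pres_equiv}.
HB.instance Definition _ := Choice.on pres_group.
HB.instance Definition _ := EqQuotient.on pres_group.

Definition pres_cls (w : word l) : pres_group := \pi w.

Lemma pres_clsP u v : pres_cls u = pres_cls v <-> pres_eq u v.
Proof.
split=> [/eqmodP /asboolP //|h]; apply/eqmodP; exact/asboolP.
Qed.

Lemma pres_eqL w u v : pres_eq u v -> pres_eq (w ++ u) (w ++ v).
Proof.
elim=> [x|x y _|x y z _ + _|x a y|x i y].
- exact: PresRefl.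
- exact: PresSym.
- exact: PresTrans.
- by rewrite !catA; apply: PresCancel.
- by rewrite catA [X in pres_eq _ X]catA; apply: PresRel.
Qed.

Lemma pres_eqR w u v : pres_eq u v -> pres_eq (u ++ w) (v ++ w).
Proof.
elim=> [x|x y _|x y z _ + _|x a y|x i y].
- exact: PresRefl.
- exact: PresSym.
- exact: PresTrans.
- by rewrite -!catA; apply: PresCancel.
- by rewrite -!catA; apply: PresRel.
Qed.

Lemma pres_eq_cat u u' v v' :
  pres_eq u u' -> pres_eq v v' -> pres_eq (u ++ v) (u' ++ v').
Proof. by move=> hu hv; apply: PresTrans (pres_eqR _ hu) (pres_eqL _ hv). Qed.

Lemma letter_invK (a : letter l) : letter_inv (letter_inv a) = a.
Proof. by case: a => i b; rewrite /letter_inv /= negbK. Qed.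

Lemma word_inv_cat (u v : word l) :
  word_inv (u ++ v) = word_inv v ++ word_inv u.
Proof. by rewrite /word_inv map_cat rev_cat. Qed.

Lemma word_inv_cons a (v : word l) :
  word_inv (a :: v) = word_inv v ++ [:: letter_inv a].
Proof. by rewrite /word_inv /= rev_cons cats1. Qed.

Lemma word_invK (u : word l) : word_inv (word_inv u) = u.
Proof.
elim: u => // a u IH.
by rewrite word_inv_cons word_inv_cat IH /word_inv /= letter_invK.
Qed.

Lemma pres_eqVw (w : word l) : pres_eq (word_inv w ++ w) [::].
Proof.
elim: w => [|a w IH]; first exact: PresRefl.
rewrite word_inv_cons -catA /=.
apply: PresTrans IH.
by have := PresCancel (word_inv w) (letter_inv a) w; rewrite letter_invK.
Qed.

Lemma pres_eqwV (w : word l) : pres_eq (w ++ word_inv w) [::].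
Proof. by have := pres_eqVw (word_inv w); rewrite word_invK. Qed.

Lemma pres_eq_inv u v : pres_eq u v -> pres_eq (word_inv u) (word_inv v).
Proof.
move=> h.
have h1 : pres_eq (word_inv u) (word_inv u ++ v ++ word_inv v).
  have := pres_eqL (word_inv u) (pres_eqwV v); rewrite cats0.
  exact: PresSym.
apply: (PresTrans h1).
apply: (PresTrans (pres_eqL _ (pres_eqR _ (PresSym h)))).
by rewrite catA; apply: (pres_eqR _ (pres_eqVw u)).
Qed.

Definition pres_mul (g h : pres_group) : pres_group :=
  pres_cls (repr g ++ repr h).
Definition pres_one : pres_group := pres_cls [::].
Definition pres_inv (g : pres_group) : pres_group :=
  pres_cls (word_inv (repr g)).

Lemma pres_cls_repr (g : pres_group) : pres_cls (repr g) = g.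
Proof. exact: reprK. Qed.

Lemma pres_repr_cls (w : word l) : pres_eq (repr (pres_cls w)) w.
Proof. by apply/pres_clsP; rewrite pres_cls_repr. Qed.

Lemma pres_cls_cat u v : pres_cls (u ++ v) = pres_mul (pres_cls u) (pres_cls v).
Proof.
apply/pres_clsP/PresSym.
by apply: pres_eq_cat; apply: pres_repr_cls.
Qed.

Lemma pres_cls_inv u : pres_cls (word_inv u) = pres_inv (pres_cls u).
Proof. apply/pres_clsP/PresSym/pres_eq_inv; exact: pres_repr_cls. Qed.

Lemma pres_mulA : associative pres_mul.
Proof.
move=> f g h; rewrite -(pres_cls_repr f) -(pres_cls_repr g) -(pres_cls_repr h).
by rewrite -!pres_cls_cat catA.
Qed.

Lemma pres_mul1 : left_id pres_one pres_mul.
Proof. by move=> g; rewrite -(pres_cls_repr g) -pres_cls_cat. Qed.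

Lemma pres_mulr1 : right_id pres_one pres_mul.
Proof. by move=> g; rewrite -(pres_cls_repr g) -pres_cls_cat cats0. Qed.

Lemma pres_mulV : left_inverse pres_one pres_inv pres_mul.
Proof.
move=> g; rewrite -(pres_cls_repr g) -pres_cls_inv -pres_cls_cat.
by apply/pres_clsP; apply: pres_eqVw.
Qed.

Lemma pres_mulrV : right_inverse pres_one pres_inv pres_mul.
Proof.
move=> g; rewrite -(pres_cls_repr g) -pres_cls_inv -pres_cls_cat.
by apply/pres_clsP; apply: pres_eqwV.
Qed.

HB.instance Definition _ :=
  isGroup.Build pres_group pres_mulA pres_mul1 pres_mulr1 pres_mulV pres_mulrV.

End PresentedGroup.

(* An element of Z[F_l] is represented by a formal sum of words with integer
   coefficients; [fox j w] is the free differential dw/dx_j, computed from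
   d(a w)/dx_j = da/dx_j + a dw/dx_j and d(x_j^-1)/dx_j = - x_j^-1. *)
Definition zword (l : nat) : Type := seq (int * word l).

Fixpoint fox l (j : 'I_l) (w : word l) : zword l :=
  if w isn't a :: w' then [::] else
  (if a.1 == j then (if a.2 then [:: (-1, [:: a])] else [:: (1, [::])])
   else [::]) ++ [seq (c.1, a :: c.2) | c <- fox j w'].

Section TwistedAlexander.
Variables (C : fieldType) (mu n k : nat) (r : 'I_k -> word k.+1).
Local Notation G := (pres_group r).
Local Notation ratfun := {fraction (mpoly mu C)}.
(* The exponent vector of t_1^(e_1) ... t_mu^(e_mu) stands for the monomial. *)
Variables (alpha : G -> 'rV[int]_mu) (phi : G -> 'M[C]_n).

Definition tvar (i : 'I_mu) : ratfun := tofrac (mpolyX C (mnm1 i)).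

Definition tmon (e : 'rV[int]_mu) : ratfun := \prod_(i < mu) tvar i ^ e 0 i.

Definition tconst (c : C) : ratfun := tofrac (mpolyC mu c).

Definition twist_word (w : word k.+1) : 'M[ratfun]_n :=
  tmon (alpha (pres_cls r w)) *: map_mx tconst (phi (pres_cls r w)).

Definition twist (s : zword k.+1) : 'M[ratfun]_n :=
  \sum_(c <- s) twist_word c.2 *~ c.1.

Definition fox_minor (j : 'I_k.+1) : 'M[ratfun]_(\sum_(i < k) n) :=
  \mxblock_(i < k, j' < k) twist (fox (lift j j') (r i)).

Definition wada_denom (j : 'I_k.+1) : ratfun :=
  \det (twist [:: (1, word_gen j); (-1, [::])]).

(* The twisted Alexander polynomial as a class: the set of all its
   representatives, for all admissible j and up to the indeterminacy
   t_1^(n e_1) ... t_mu^(n e_mu), and up to sign if n is odd. *)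
Definition twisted_alexander : set ratfun :=
  [set f | exists (j : 'I_k.+1) (e : 'rV[int]_mu) (b : bool),
     [/\ wada_denom j != 0, (b -> odd n) &
         f = (-1) ^+ b * tmon (e *+ n) * (\det (fox_minor j) / wada_denom j)]].

End TwistedAlexander.

Section TorusLink.
Variables (mu p q : nat).

(* The generators m_1, ..., m_(mu-1), x, y have indices 0, ..., mu-2, mu-1,
   mu; the relators are [x^p, m_i], of index i-1 < mu-1, and x^p y^-q, of
   index mu-1. *)
Definition gen_m (i : 'I_mu) : 'I_mu.+1 := widen_ord (leqnSn mu) i.
Definition gen_x : 'I_mu.+1 := inord mu.-1.
Definition gen_y : 'I_mu.+1 := ord_max.

Definition link_rel (i : 'I_mu) : word mu.+1 :=
  if (i < mu.-1)%N
  then word_comm (word_pow (word_gen gen_x) p) (word_gen (gen_m i))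
  else word_pow (word_gen gen_x) p ++ word_inv (word_pow (word_gen gen_y) q).

Definition link_group : Type := pres_group link_rel.
HB.instance Definition _ := Group.on link_group.

Definition link_gen (i : 'I_mu.+1) : link_group :=
  pres_cls link_rel (word_gen i).

Definition alpha_gen (i : 'I_mu.+1) : 'rV[int]_mu :=
  if (i < mu.-1)%N then \row_j ((j == i :> nat)%:Z)
  else if i == gen_x then const_mx q%:Z else const_mx p%:Z.

Definition alpha_word (w : word mu.+1) : 'rV[int]_mu :=
  \sum_(a <- w) (if a.2 then - alpha_gen a.1 else alpha_gen a.1).

Definition alpha_link (g : link_group) : 'rV[int]_mu := alpha_word (repr g).

Lemma alpha_word_cat u v : alpha_word (u ++ v) = alpha_word u + alpha_word v.
Proof. by rewrite /alpha_word big_cat. Qed.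

Lemma alpha_word_inv u : alpha_word (word_inv u) = - alpha_word u.
Proof.
elim: u => [|a u IH]; first by rewrite /alpha_word big_nil oppr0.
rewrite word_inv_cons alpha_word_cat IH /alpha_word !big_cons big_nil addr0 opprD addrC.
by congr (_ + _); case: a => i [] /=; rewrite ?opprK.
Qed.

Lemma alpha_word_pow u m : alpha_word (word_pow u m) = alpha_word u *+ m.
Proof.
elim: m => [|m IH]; first by rewrite /alpha_word big_nil mulr0n.
by rewrite [word_pow _ _]/(u ++ word_pow u m) alpha_word_cat IH mulrS.
Qed.

Lemma alpha_word_gen i : alpha_word (word_gen i) = alpha_gen i.
Proof. by rewrite /alpha_word big_seq1. Qed.

Lemma alpha_gen_x : alpha_gen gen_x = const_mx q%:Z.
Proof. by rewrite /alpha_gen eqxx inordK ?ltnn ?ltnS ?leq_pred. Qed.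

Lemma alpha_gen_y : (0 < mu)%N -> alpha_gen gen_y = const_mx p%:Z.
Proof.
move=> mu0; rewrite /alpha_gen ltnNge leq_pred /=.
case: eqP => // /(congr1 val) /=; rewrite inordK ?ltnS ?leq_pred // => e.
by move: mu0; rewrite e; case: (mu) e => // m; move/eqP; rewrite /= -[X in X == _]addn1 -[X in _ == X]addn0 eqn_add2l.
Qed.

Lemma alpha_word_rel i : alpha_word (link_rel i) = 0.
Proof.
have mu0 : (0 < mu)%N by case: i => i; apply: leq_ltn_trans.
rewrite /link_rel; case: ifP => _.
  rewrite /word_comm !alpha_word_cat !alpha_word_inv.
  by rewrite [X in _ + X]addrCA subrr addr0 subrr.
rewrite alpha_word_cat alpha_word_inv !alpha_word_pow !alpha_word_gen.
rewrite alpha_gen_x alpha_gen_y //; apply/matrixP=> a b.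
by rewrite !mxE !mulmxnE !mxE -(mulr_natr q%:Z p) -(mulr_natr p%:Z q) !natz mulrC subrr.
Qed.

Lemma alpha_word_pres_eq u v : pres_eq link_rel u v -> alpha_word u = alpha_word v.
Proof.
elim=> [//|//|x y z _ -> _ -> //|x a y|x i y].
  rewrite !alpha_word_cat; congr (_ + _).
  by rewrite /alpha_word !big_cons addrA; case: a => i [] /=; rewrite ?subrr ?addNr add0r.
by rewrite !alpha_word_cat alpha_word_rel add0r.
Qed.

Lemma alpha_link_cls w : alpha_link (pres_cls link_rel w) = alpha_word w.
Proof. exact/alpha_word_pres_eq/pres_repr_cls. Qed.

Lemma alpha_linkM g h : alpha_link (g * h)%g = alpha_link g + alpha_link h.
Proof. by rewrite alpha_link_cls alpha_word_cat. Qed.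

End TorusLink.

(* The structure annotation is what gives R[i] the topology of its norm. *)
Definition Cplx (R : realType) : numClosedFieldType := R[i].

Section SymPower.
Variable C : fieldType.

(* (P . f)(z) = f (P^-1 z) on polynomials in z_1, z_2. *)
Definition sl_act (P : 'M[C]_2) (f : mpoly 2 C) : mpoly 2 C :=
  comp_mpoly
    [tuple \sum_(j < 2) invmx P i j *: mpolyX C (mnm1 j) | i < 2] f.

Definition form_mon (n : nat) (j : 'I_n) : multinom 2 :=
  Multinom [tuple if i == ord0 then (n.-1 - j)%N else j | i < 2].

(* The basis of V_n is z_1^(n-1-j) z_2^j, 0 <= j < n, with images in columns,
   so that sigma is multiplicative (and not anti-multiplicative). *)
Definition sigma (n : nat) (P : 'M[C]_2) : 'M[C]_n :=
  \matrix_(i < n, j < n)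
    mcoeff (form_mon i) (sl_act P (mpolyX C (form_mon j))).

End SymPower.

Definition SL_rep (C : fieldType) (G : groupType) (n : nat)
    (phi : G -> 'M[C]_n) : Prop :=
  [/\ forall g, \det (phi g) = 1, phi 1%g = 1%:M &
      forall g h, phi (g * h)%g = phi g *m phi h].

Definition irreducible_rep (C : fieldType) (G : groupType) (n : nat)
    (phi : G -> 'M[C]_n) : Prop :=
  forall W : {vspace 'cV[C]_n},
    (forall g v, v \in W -> phi g *m v \in W) -> W = 0%VS \/ W = fullv.

Section CharacterVariety.
Variables (R : realType) (mu p q : nat).
Local Notation C := (Cplx R).
Local Notation G := (link_group mu p q).

Definition irrep_set : Type :=
  {rho : G -> 'M[C]_2 | `[< SL_rep rho /\ irreducible_rep rho >]}.
HB.instance Definition _ := gen_eqMixin irrep_set.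
HB.instance Definition _ := gen_choiceMixin irrep_set.

Definition irrep_coord (rho : irrep_set) :
    prod_topology (fun _ : 'I_mu.+1 => 'M[C]_2) :=
  fun i => sval rho (link_gen p q i).

Definition irrep : Type := initial_topology irrep_coord.
HB.instance Definition _ := Topological.on irrep.

Definition irrep_fun (rho : irrep) : G -> 'M[C]_2 := sval rho.

Definition irrep_conj (rho rho' : irrep) : Prop :=
  exists2 P : 'M[C]_2, \det P = 1 &
    forall g, irrep_fun rho' g = P *m irrep_fun rho g *m invmx P.

Definition irrep_conjb (rho rho' : irrep) : bool := `[< irrep_conj rho rho' >].

Lemma irrep_conjb_equiv : equiv_class_of irrep_conjb.
Proof.
have unit1 (P : 'M[C]_2) : \det P = 1 -> P \in unitmx.
  by move=> h; rewrite unitmxE h unitr1.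
have sym rho rho' : irrep_conj rho rho' -> irrep_conj rho' rho.
  case=> P dP h; exists (invmx P); first by rewrite det_inv dP invr1.
  move=> g; rewrite h invmxK -!mulmxA mulVmx ?unit1 // mulmx1.
  by rewrite mulmxA mulVmx ?unit1 // mul1mx.
split=> [rho|rho rho'|rho2 rho1 rho3].
- apply/asboolP; exists 1%:M; first exact: det1.
  by move=> g; rewrite invmx1 mulmx1 mul1mx.
- by apply/asboolP/asboolP; apply: sym.
- move=> /asboolP[P dP h] /asboolP[Q dQ h']; apply/asboolP.
  have PQ : \det (Q *m P) = 1 by rewrite det_mulmx dP dQ mulr1.
  exists (Q *m P) => // g; rewrite h' h.
  suff -> : invmx (Q *m P) = invmx P *m invmx Q by rewrite !mulmxA.
  rewrite -[RHS]mul1mx -(mulVmx (unit1 _ PQ)) -!mulmxA -[LHS]mulmx1; congr (_ *m _).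
  by rewrite [P *m _]mulmxA mulmxV ?unit1 // mul1mx mulmxV ?unit1 // mulmx1.
Qed.

Canonical irrep_conj_equiv := EquivRelPack irrep_conjb_equiv.

Definition char_variety : Type :=
  quotient_topology {eq_quot irrep_conj_equiv}.
HB.instance Definition _ := Topological.on char_variety.

Definition char_cls (rho : irrep) : char_variety :=
  \pi_(char_variety) rho.

Definition link_twisted_alexander (n : nat) (rho : irrep) :
    set {fraction (mpoly mu C)} :=
  twisted_alexander (@alpha_link mu p q)
    (fun g => sigma n (irrep_fun rho g)).

End CharacterVariety.

(* Main.v *)
Require Import Defs.
From mathcomp Require Import all_boot all_order all_algebra.
From mathcomp Require Import all_classical all_reals all_analysis.
From mathcomp Require Import perm zify.
From mathcomp Require Import -(notations) mpoly.

(** The group of the torus link T(mu p, mu q) has generators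
    m_1, ..., m_(mu-1), x, y and relators [x^p, m_i] and x^p = y^q.

    The twisted Alexander polynomial can be written with x and y alone.  The Fox
    matrix is so sparse that each minor, with its columns permuted suitably, is
    block diagonal up to one block column, so its determinant is a product
    ([det_link_minor]) of
    - det (Phi(x^p) - 1), for the relators [x^p, m_i];
    - det (1 + Phi(x) + ... + Phi(x)^(p-1)), or the same in y up to sign;
    - det (1 - Phi(m_j)) if m_j is the deleted generator, which cancels against
      the denominator.
    Hence for every admissible deleted generator the quotient depends only on
    the conjugacy classes of the images of x and of y ([link_minor_ratio],
    [twisted_alexander_similar]).  Since sigma_n is multiplicative
    ([sigma_mul]), it is enough to know the conjugacy classes of rho(x) and
    rho(y) separately ([sigma_twisted_alexander_similar]).

    These conjugacy classes are locally constant.  The element x^p = y^q is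
    central, so for irreducible rho Schur's lemma makes its image a scalar of
    determinant 1, and rho(x)^(2p) = rho(y)^(2q) = 1 ([fibre_pow_order]).  If
    X^N = Y^N = 1 then the sum of the Y^i X^(N-i) over 0 <= i < N intertwines X
    and Y; it is N times the identity at Y = X, so it is invertible for Y near X
    ([near_similar]).  The representations whose x and y are conjugate to
    those of a given one therefore form an open set, which is stable under
    conjugation, and whose image in the character variety is the required
    neighbourhood. *)

Set Implicit Arguments.
Unset Strict Implicit.
Unset Printing Implicit Defensive.

Import Order.TTheory GRing.Theory Num.Theory.
Import numFieldNormedType.Exports.

Local Open Scope classical_set_scope.
Local Open Scope ring_scope.
Local Open Scope quotient_scope.

(** * Determinants of block matrices *)

Section BlockDeterminants.
Variable R : comRingType.

Lemma det_castmx m n (e : m = n) (A : 'M[R]_m) :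
  \det (castmx (e, e) A) = \det A.
Proof. by case: n / e; rewrite castmx_id. Qed.

Lemma det_mxblock_lower k (s : 'I_k -> nat)
    (B : forall i j, 'M[R]_(s i, s j)) :
  (forall i j : 'I_k, (i < j)%N -> B i j = 0) ->
  \det (\mxblock_(i, j) B i j) = \prod_i \det (B i i).
Proof.
elim: k s B => [|k IH] s B B0.
  rewrite [RHS]big_ord0; move: (\mxblock_(i, j) B i j).
  have : (\sum_(i < 0) s i)%N = 0%N by rewrite big_ord0.
  by move: (\sum_i s i)%N => m m0; rewrite m0 => M; rewrite det_mx00.
rewrite mxblock_recul [RHS]big_ord_recl.
rewrite -(IH _ (fun i j => B (lift ord0 i) (lift ord0 j))); last first.
  by move=> i j ij; apply: B0.
have -> : \mxrow_j B ord0 (lift ord0 j) = 0.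
  by apply/matrixP=> a b; rewrite !mxE B0 // mxE.
move: (\mxblock_(i, j) _) (\mxcol_i _) => M N.
by rewrite det_castmx det_lblock.
Qed.

Lemma det_mxblock_upper k (s : 'I_k -> nat)
    (B : forall i j, 'M[R]_(s i, s j)) :
  (forall i j : 'I_k, (j < i)%N -> B i j = 0) ->
  \det (\mxblock_(i, j) B i j) = \prod_i \det (B i i).
Proof.
move=> B0; rewrite -det_tr tr_mxblock det_mxblock_lower.
  by apply: eq_bigr => i _; rewrite det_tr.
by move=> i j ij; rewrite B0 // trmx0.
Qed.

(** Such a matrix is the product of a block upper triangular one, carrying the
    upper half of column [c] including its diagonal block, and a block lower
    triangular one carrying everything else.  Putting the block [B c c] in the
    left factor makes the factorization valid without inverting any block. *)
Lemma det_mxblock_one_column k n (c : 'I_k) (B : 'I_k -> 'I_k -> 'M[R]_n) :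
  (forall i j, i != j -> j != c -> B i j = 0) ->
  \det (\mxblock_(i < k, j < k) B i j) = \prod_i \det (B i i).
Proof.
move=> B0.
pose U (i j : 'I_k) : 'M[R]_n :=
  if (i <= j)%N && (j == c) then B i j else if i == j then 1%:M else 0.
pose L (i j : 'I_k) : 'M[R]_n :=
  if (i <= j)%N && (j == c) then if i == j then 1%:M else 0 else B i j.
have -> : \mxblock_(i < k, j < k) B i j =
    (\mxblock_(i < k, j < k) U i j) *m (\mxblock_(i < k, j < k) L i j).
  rewrite mul_mxblock; apply: eq_mxblock => i j.
  rewrite (bigD1 i) //= /U leqnn eqxx /=.
  case: (eqVneq i c) => [->|ic].
    rewrite big1 => [|l lc]; last first.
      by rewrite (negbTE lc) andbF eq_sym (negbTE lc) mul0mx.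
    rewrite addr0 /L; case: (eqVneq j c) => [->|jc]; first by rewrite leqnn mulmx1.
    by rewrite andbF (B0 c j) ?mulmx0 // eq_sym.
  rewrite mul1mx (bigD1 c) 1?eq_sym //= eqxx andbT.
  rewrite big1 => [|l /andP[li lc]]; last first.
    by rewrite (negbTE lc) andbF eq_sym (negbTE li) mul0mx.
  rewrite addr0 /L; case: (eqVneq j c) => [->|jc].
    rewrite andbT (negbTE ic); case: ifP => _.
      by rewrite leqnn ?eqxx mulmx1 add0r.
    by rewrite eq_sym (negbTE ic) mul0mx addr0.
  by rewrite !andbF (B0 c j) ?mulmx0 ?addr0 // eq_sym.
rewrite det_mulmx det_mxblock_upper => [|i j ji]; last first.
  by rewrite /U leqNgt ji /= eq_sym -val_eqE (ltn_eqF ji).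
rewrite det_mxblock_lower => [|i j ij]; last first.
  rewrite /L (ltnW ij) /=; have ne : i != j by rewrite -val_eqE (ltn_eqF ij).
  by case: eqP => [_|/eqP jc]; [rewrite (negbTE ne) | rewrite B0].
rewrite -big_split /=; apply: eq_bigr => i _.
by rewrite /U /L leqnn eqxx /=; case: ifP; rewrite det1 ?mulr1 ?mul1r.
Qed.

End BlockDeterminants.

(** * Multiplicativity of symmetric powers *)

Section SymmetricPower.
Variable C : fieldType.
Local Notation mX := (@mpolyX _ C).

(** [sl_act P] is [lin_subst (invmx P)]; dropping the inverse turns the
    action into a rule valid for all matrices. *)
Definition lin_subst (A : 'M[C]_2) (f : mpoly 2 C) : mpoly 2 C :=
  comp_mpoly [tuple \sum_(j < 2) A i j *: mX (mnm1 j) | i < 2] f.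

Lemma lin_subst_comp (A B : 'M[C]_2) f :
  lin_subst A (lin_subst B f) = lin_subst (B *m A) f.
Proof.
rewrite [in LHS]/lin_subst [comp_mpoly _ f]comp_mpolyEX raddf_sum /=.
rewrite [RHS]comp_mpolyEX; apply: eq_bigr => m _; rewrite comp_mpolyZ; congr (_ *: _).
rewrite !comp_mpolyX rmorph_prod /=; apply: eq_bigr => i _.
rewrite rmorphXn /=; congr (_ ^+ _).
rewrite !tnth_mktuple raddf_sum /=.
under eq_bigr do rewrite comp_mpolyZ comp_mpolyXU -tnth_nth tnth_mktuple scaler_sumr.
rewrite exchange_big /=; apply: eq_bigr => j _.
rewrite mxE scaler_suml; apply: eq_bigr => l _.
by rewrite scalerA.
Qed.

Lemma lin_subst1 f : lin_subst 1%:M f = f.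
Proof.
rewrite -[RHS]comp_mpoly_id /lin_subst; congr comp_mpoly.
apply: eq_from_tnth => i; rewrite !tnth_mktuple (bigD1 i) //= mxE eqxx scale1r.
by rewrite big1 ?addr0 // => j ji; rewrite mxE eq_sym (negbTE ji) scale0r.
Qed.

Lemma lin_subst_homog A d m : mdeg m = d ->
  lin_subst A (mX m) \is @ishomog1 2 C d mdeg.
Proof.
move=> md; rewrite /lin_subst comp_mpolyX.
have lin i : tnth [tuple \sum_(j < 2) A i j *: mX (mnm1 j) | i < 2] i
    \is @ishomog1 2 C 1 mdeg.
  rewrite tnth_mktuple; apply: rpred_sum => j _; apply: rpredZ.
  by rewrite dhomogX; apply/eqP/mdeg1.
rewrite big_ord_recl big_ord1 -md.
have -> : mdeg m = (1 * m ord0 + 1 * m (lift ord0 ord0))%N.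
  by rewrite mdegE big_ord_recl big_ord1 !mul1n.
by apply: dhomogM; apply: dhomogMn.
Qed.

Lemma mdeg_form_mon n (j : 'I_n) : mdeg (form_mon j) = n.-1.
Proof.
rewrite mdegE big_ord_recl big_ord1 !multinomE !tnth_mktuple /= subnK //.
by case: n j => [[]//|n] j; rewrite -ltnS.
Qed.

Lemma form_mon_eq n (i j : 'I_n) : (form_mon i == form_mon j) = (i == j).
Proof.
apply/eqP/eqP => [/mnmP/(_ (lift ord0 ord0))|-> //].
by rewrite !multinomE !tnth_mktuple /= => /val_inj.
Qed.

(** The matrix [sigma n P] only records the coefficients of [sl_act P f] at the
    [form_mon i]; homogeneity guarantees that nothing is lost. *)
Lemma homog_expand n (f : mpoly 2 C) : (0 < n)%N ->
  f \is @ishomog1 2 C n.-1 mdeg ->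
  f = \sum_(i < n) mcoeff (form_mon i) f *: mX (form_mon i).
Proof.
move=> n0 hf; apply/mpolyP => m; rewrite raddf_sum /=.
under eq_bigr do rewrite mcoeffZ mcoeffX.
case: (eqVneq (mdeg m) n.-1) => md; last first.
  rewrite (dhomog_nemf_coeff hf md) big1 // => i _.
  case: eqP => [e|_]; last by rewrite mulr0.
  by move: md; rewrite -e mdeg_form_mon eqxx.
move: md; rewrite mdegE big_ord_recl big_ord1 => md.
have mn : (m (lift ord0 ord0) < n)%N.
  by rewrite -(prednK n0) ltnS -md leq_addl.
have em : form_mon (Ordinal mn) = m.
  apply/mnmP => i; rewrite multinomE tnth_mktuple /=.
  case: (unliftP ord0 i) => [j ->|->] /=; first by rewrite (ord1 j).
  by rewrite -md addnK.
rewrite (bigD1 (Ordinal mn)) //= big1 => [|i ne].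
  by rewrite em eqxx mulr1 addr0.
by rewrite -em form_mon_eq (negbTE ne) mulr0.
Qed.

Lemma sigmaE n (P : 'M[C]_2) i j :
  sigma n P i j = mcoeff (form_mon i) (lin_subst (invmx P) (mX (form_mon j))).
Proof. by rewrite mxE. Qed.

Lemma sigma_mul n (P Q : 'M[C]_2) : (0 < n)%N ->
  P \in unitmx -> Q \in unitmx -> sigma n (P *m Q) = sigma n P *m sigma n Q.
Proof.
move=> n0 uP uQ.
have inv : invmx (P *m Q) = invmx Q *m invmx P.
  have uPQ : P *m Q \in unitmx by rewrite unitmx_mul uP.
  apply: (can_inj (mulmxK uPQ)); rewrite mulVmx //.
  by rewrite -mulmxA (mulKmx uP) mulVmx.
have mulE (A B : 'M[C]_n) i j : (A *m B) i j = \sum_l A i l * B l j.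
  by rewrite mxE.
apply/matrixP => i j; rewrite [RHS]mulE [LHS]sigmaE inv -lin_subst_comp.
rewrite {1}(homog_expand n0 (lin_subst_homog (invmx Q) (mdeg_form_mon j))).
rewrite {1}/lin_subst [comp_mpoly _ _]raddf_sum raddf_sum /=; apply: eq_bigr => l _.
rewrite comp_mpolyZ mcoeffZ [RHS]mulrC; congr (_ * _); exact/esym/sigmaE.
Qed.

Lemma sigma_one n : sigma n (1%:M : 'M[C]_2) = 1%:M.
Proof.
apply/matrixP => i j; rewrite sigmaE invmx1 lin_subst1 mxE.
by rewrite mcoeffX form_mon_eq eq_sym.
Qed.

End SymmetricPower.

(** * Fox calculus under a twisted representation *)

Section FoxCalculus.
Variables (C : fieldType) (mu n k : nat) (r : 'I_k -> word k.+1).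
Local Notation G := (pres_group r).
Local Notation ratfun := {fraction (mpoly mu C)}.
Variables (alpha : G -> 'rV[int]_mu) (phi : G -> 'M[C]_n).
Hypothesis alphaM : forall g h, alpha (g * h)%g = alpha g + alpha h.
Hypothesis phi1 : phi 1%g = 1%:M.
Hypothesis phiM : forall g h, phi (g * h)%g = phi g *m phi h.

Lemma tvar_neq0 (i : 'I_mu) : tvar C i != 0.
Proof.
rewrite tofrac_eq0; apply/negP => /eqP/(congr1 (mcoeff (mnm1 i)))/eqP.
by rewrite mcoeffX eqxx mcoeff0 oner_eq0.
Qed.

Lemma tmon0 : tmon C (0 : 'rV[int]_mu) = 1.
Proof. by rewrite /tmon big1 // => i _; rewrite mxE expr0z. Qed.

Lemma tmonD (a b : 'rV[int]_mu) : tmon C (a + b) = tmon C a * tmon C b.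
Proof.
rewrite /tmon -big_split /=; apply: eq_bigr => i _.
by rewrite mxE expfzDr ?tvar_neq0.
Qed.

Lemma tconst_mx1 m : map_mx (tconst mu) (1%:M : 'M[C]_m) = 1%:M.
Proof.
by rewrite (_ : map_mx _ _ = map_mx (@tofrac (mpoly mu C) \o @mpolyC mu C) 1%:M)
  ?map_mx1.
Qed.

Lemma tconst_mxM m l s (A : 'M[C]_(m, l)) (B : 'M[C]_(l, s)) :
  map_mx (tconst mu) (A *m B) = map_mx (tconst mu) A *m map_mx (tconst mu) B.
Proof.
have E u v (M : 'M[C]_(u, v)) :
  map_mx (tconst mu) M = map_mx (@tofrac (mpoly mu C) \o @mpolyC mu C) M by [].
by rewrite !E map_mxM.
Qed.

Local Notation tw := (twist_word alpha phi).
Local Notation dfox j w := (twist alpha phi (fox j w)).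

Lemma twist_word_cat u v : tw (u ++ v) = tw u *m tw v.
Proof.
rewrite /twist_word pres_cls_cat phiM tconst_mxM alphaM tmonD.
by rewrite -scalemxAl -scalemxAr scalerA.
Qed.

Lemma twist_word_nil : tw [::] = 1%:M.
Proof.
rewrite /twist_word phi1 tconst_mx1.
have -> : alpha (pres_cls r [::]) = 0; last by rewrite tmon0 scale1r.
have : alpha (1 * 1)%g = alpha 1%g by rewrite mulg1.
by rewrite alphaM => /eqP; rewrite -subr_eq0 addrK => /eqP.
Qed.

Lemma twist_word_eq u v : pres_eq r u v -> tw u = tw v.
Proof. by move=> /pres_clsP uv; rewrite /twist_word uv. Qed.

Lemma twist_word_invl u : tw (word_inv u) *m tw u = 1%:M.
Proof. by rewrite -twist_word_cat (twist_word_eq (pres_eqVw r u)) twist_word_nil. Qed.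

Lemma twist_word_rel i : tw (r i) = 1%:M.
Proof.
have h := PresRel r [::] i [::]; rewrite cats0 /= in h.
by rewrite (twist_word_eq h) twist_word_nil.
Qed.

Lemma fox_cat (j : 'I_k.+1) u v :
  fox j (u ++ v) = fox j u ++ [seq (c.1, u ++ c.2) | c <- fox j v].
Proof.
elim: u => [|a u IH] /=; first by rewrite -[LHS]map_id; apply: eq_map => -[].
by rewrite IH map_cat -catA -map_comp.
Qed.

Lemma twist_fox_cat j u v : dfox j (u ++ v) = dfox j u + tw u *m dfox j v.
Proof.
rewrite fox_cat /twist big_cat /= big_map mulmx_sumr; congr (_ + _).
by apply: eq_bigr => c _ /=; rewrite twist_word_cat -!scaler_int scalemxAr.
Qed.

Lemma twist_fox_nil j : dfox j [::] = 0.
Proof. by rewrite /twist big_nil. Qed.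

Lemma twist_fox_gen j i : dfox j (word_gen i) = if i == j then 1%:M else 0.
Proof.
rewrite /twist /= cats0; case: ifP => _; last by rewrite big_nil.
by rewrite big_seq1 /= twist_word_nil mulr1z.
Qed.

Lemma twist_fox_letter_inv j (a : letter k.+1) :
  dfox j [:: letter_inv a] = - (tw [:: letter_inv a] *m dfox j [:: a]).
Proof.
case: a => i b; rewrite /twist /= !cats0; case: ifP => _; last first.
  by rewrite !big_nil mulmx0 oppr0.
case: b; rewrite /= !big_seq1 /=.
  rewrite twist_word_nil mulr1z mulrN1z mulmxN opprK.
  by rewrite -(twist_word_invl [:: (i, true)]).
by rewrite twist_word_nil mulr1z mulmx1 mulrN1z.
Qed.

Lemma twist_fox_inv j u : dfox j (word_inv u) = - (tw (word_inv u) *m dfox j u).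
Proof.
elim: u => [|a u IH]; first by rewrite twist_fox_nil mulmx0 oppr0.
rewrite word_inv_cons twist_fox_cat IH -[a :: u]cat1s twist_fox_cat.
rewrite twist_fox_letter_inv twist_word_cat mulmxDr opprD addrC mulmxN.
rewrite -!mulmxA; congr (_ + - (_ *m _)).
by rewrite mulmxA (twist_word_invl [:: a]) mul1mx.
Qed.

(** The twisted Fox derivative of the power [u]^m with respect to [u]. *)
Definition geom_sum u m : 'M[ratfun]_n := \sum_(i < m) tw (word_pow u i).

Lemma twist_fox_pow j u m :
  dfox j (word_pow u m) = geom_sum u m *m dfox j u.
Proof.
rewrite /geom_sum; elim: m => [|m IH].
  by rewrite big_ord0 mul0mx twist_fox_nil.
rewrite [word_pow _ _]/(u ++ word_pow u m) twist_fox_cat IH big_ord_recl.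
rewrite twist_word_nil mulmxDl mul1mx mulmxA; congr (_ + _ *m _); rewrite mulmx_sumr.
by apply: eq_bigr => i _; rewrite -twist_word_cat.
Qed.

Lemma wada_denomE j : wada_denom alpha phi j = \det (tw (word_gen j) - 1%:M).
Proof.
by rewrite /wada_denom /twist big_cons big_seq1 /= twist_word_nil mulr1z mulrN1z.
Qed.

(** At t = 0 the matrix in the denominator, whose entries are then polynomials,
    becomes minus the identity. *)
Lemma wada_denom_neq0 j (m : multinom mu) : m != mnm0 ->
  alpha (pres_cls r (word_gen j)) = \row_i (m i)%:Z ->
  wada_denom alpha phi j != 0.
Proof.
move=> m0 am; rewrite wada_denomE /twist_word am.
have -> : tmon C (\row_i (m i)%:Z) = tofrac (mpolyX C m).
  rewrite mpolyXE_id rmorph_prod; apply: eq_bigr => i _.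
  by rewrite rmorphXn mxE.
set A := phi _.
have -> : tofrac (mpolyX C m) *: map_mx (tconst mu) A - 1%:M =
    map_mx (@tofrac (mpoly mu C)) (mpolyX C m *: map_mx (@mpolyC mu C) A - 1%:M).
  by rewrite map_mxB map_mxZ map_mx1 -map_mx_comp.
rewrite det_map_mx tofrac_eq0; apply/negP => /eqP.
move/(congr1 (meval (fun=> 0))); rewrite -det_map_mx map_mxB map_mxZ map_mx1 /=.
have m0ev : meval (fun=> 0) (mpolyX C m) = 0.
  have [i mi] : exists i, m i != 0%N.
    apply/existsP; apply: contraNT m0; rewrite negb_exists => /forallP h.
    by apply/eqP/mnmP => i; rewrite mnm0E; apply/eqP; move: (h i); rewrite negbK.
  by rewrite mevalX (bigD1 i) //= expr0n (negbTE mi) mul0r.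
rewrite [meval _ (mpolyX _ _)]m0ev scale0r sub0r meval0 => /eqP.
by rewrite -scaleN1r detZ det1 mulr1 expf_eq0 oppr_eq0 oner_eq0 andbF.
Qed.

(** The block matrix that moves columns [tau] of the Fox matrix to the columns
    other than [j], in increasing order.  It does not involve the
    representation, so comparing two representations does not require evaluating
    its determinant, which is a sign when [tau] enumerates these columns. *)
Definition select_mx (j : 'I_k.+1) (tau : 'I_k -> 'I_k.+1) :
    'M[ratfun]_(\sum_(i < k) n) :=
  \mxblock_(s < k, l < k) (if lift j l == tau s then 1%:M else 0 : 'M[ratfun]_n).

Lemma fox_minor_select j (tau : 'I_k -> 'I_k.+1) :
  injective tau -> (forall s, tau s != j) ->
  fox_minor alpha phi j =
  \mxblock_(i < k, s < k) dfox (tau s) (r i) *m select_mx j tau.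
Proof.
move=> tau_inj tauj; rewrite mul_mxblock; apply: eq_mxblock => i l.
pose f s := odflt s (unlift j (tau s)).
have tauE s : tau s = lift j (f s).
  by rewrite /f; case: unliftP => [? ->//|e]; move: (tauj s); rewrite e eqxx.
have f_inj : injective f by move=> s t e; apply: tau_inj; rewrite !tauE e.
have tau_inv : tau (invF f_inj l) = lift j l by rewrite tauE f_invF.
rewrite (bigD1 (invF f_inj l)) //= tau_inv eqxx mulmx1 big1 ?addr0 // => s sl.
rewrite -tau_inv eq_sym (inj_eq tau_inj) (negbTE sl); exact: mulmx0.
Qed.

End FoxCalculus.

(** * The minors of a torus link *)

Section LinkMinors.
Variables (C : fieldType) (mu p q n : nat).
Hypothesis mu_gt0 : (0 < mu)%N.
Local Notation ratfun := {fraction (mpoly mu C)}.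
Local Notation alpha := (@alpha_link mu p q).
Local Notation X := (word_gen (gen_x mu)).
Local Notation Y := (word_gen (gen_y mu)).

Lemma gen_x_val : gen_x mu = mu.-1 :> nat.
Proof. by rewrite inordK // ltnS leq_pred. Qed.

Lemma gen_x_neq_y : (gen_x mu == gen_y mu) = false.
Proof. by rewrite -val_eqE /= gen_x_val ltn_eqF // prednK. Qed.

Lemma gen_m_neq_x (s : 'I_mu) : (s < mu.-1)%N -> (gen_m s == gen_x mu) = false.
Proof. by move=> h; rewrite -val_eqE /= gen_x_val ltn_eqF. Qed.

(** Every generator may be deleted, whatever the representation, because its
    degree vector is nonnegative and nonzero. *)
Lemma link_denom_neq0 (phi : link_group mu p q -> 'M[C]_n) j :
  (0 < p)%N -> (0 < q)%N ->
  phi 1%g = 1%:M ->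
  wada_denom alpha phi j != 0.
Proof.
move=> p0 q0 phi1.
pose i0 := Ordinal mu_gt0.
have const_neq0 a : (0 < a)%N -> Multinom [tuple a | _ < mu] != mnm0.
  move=> a0; apply/eqP => /mnmP/(_ i0); rewrite multinomE tnth_mktuple mnm0E => e.
  by rewrite e in a0.
have [m m0 am] : exists2 m : multinom mu, m != mnm0 &
    alpha_gen p q j = \row_i (m i)%:Z.
  rewrite /alpha_gen; case: ifP => [jlt|_].
    have jmu : (j < mu)%N by rewrite (leq_trans jlt) ?leq_pred.
    exists (mnm1 (Ordinal jmu)).
      by apply/eqP => /mnmP/(_ (Ordinal jmu))/eqP; rewrite mnm1E mnm0E eqxx.
    by apply/rowP => l; rewrite !mxE mnm1E eq_sym -val_eqE.
  case: ifP => _; [exists (Multinom [tuple q | _ < mu])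
                  |exists (Multinom [tuple p | _ < mu])];
    rewrite ?const_neq0 //; apply/rowP => l; rewrite !mxE multinomE tnth_mktuple //.
apply: (wada_denom_neq0 (@alpha_linkM mu p q) phi1 m0).
by rewrite alpha_link_cls alpha_word_gen.
Qed.

(** A bijection from the relators to the generators other than [j], chosen so
    that, with columns ordered accordingly, the Fox matrix has nonzero
    off-diagonal blocks in at most one column, that of x.  The relator
    [x^p, m_s] is matched with m_s, or with x when m_s is deleted; the relator
    x^p y^-q is matched with y, or with x when y is deleted. *)
Definition col_gen (j : 'I_mu.+1) (s : 'I_mu) : 'I_mu.+1 :=
  if (s < mu.-1)%N then if gen_m s == j then gen_x mu else gen_m s
  else if j == gen_y mu then gen_x mu else gen_y mu.

Lemma col_gen_val j s : col_gen j s = (if s < mu.-1 then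
    if s == j :> nat then mu.-1 else s else if j == mu :> nat then mu.-1 else mu)%N
  :> nat.
Proof.
rewrite /col_gen -!val_eqE /=; case: ifP => _; case: ifP => _ //;
  by rewrite gen_x_val.
Qed.

Lemma col_gen_neq j s : col_gen j s != j.
Proof.
rewrite -val_eqE /= col_gen_val; move: (ltn_ord j) (ltn_ord s) mu_gt0.
by do ?case: ifP => ?; lia.
Qed.

Lemma col_gen_inj j : injective (col_gen j).
Proof.
move=> s t /(congr1 val) /= e; apply: val_inj => /=; move: e.
rewrite !col_gen_val; move: (ltn_ord j) (ltn_ord s) (ltn_ord t) mu_gt0.
by do ?case: ifP => ?; lia.
Qed.

Section OneRepresentation.
Variable phi : link_group mu p q -> 'M[C]_n.
Hypothesis phi1 : phi 1%g = 1%:M.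
Hypothesis phiM : forall g h, phi (g * h)%g = phi g *m phi h.
Local Notation tw := (twist_word alpha phi).
Local Notation dfox j w := (twist alpha phi (fox j w)).
Let alphaM := @alpha_linkM mu p q.

Local Notation Sx := (geom_sum alpha phi X p).
Local Notation Sy := (geom_sum alpha phi Y q).

(** The derivative of x^p m x^-p m^-1 simplifies because the relator itself and
    the commutation of x^p with m hold after twisting. *)
Lemma twist_fox_meridian (i : 'I_mu) j : (i < mu.-1)%N ->
  dfox j (link_rel p q i) =
  (if gen_x mu == j then (1%:M - tw (word_gen (gen_m i))) *m Sx else 0) +
  (if gen_m i == j then tw (word_pow X p) - 1%:M else 0).
Proof.
move=> ilt; set M := word_gen (gen_m i).
have := twist_word_rel alphaM phi1 i.
rewrite /link_rel ilt /word_comm !(twist_word_cat alphaM phiM).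
rewrite !(twist_fox_cat alphaM phiM) !(twist_fox_inv alphaM phi1 phiM).
rewrite (twist_fox_pow alphaM phi1 phiM) !(twist_fox_gen alphaM phi1) -/M.
have := twist_word_invl alphaM phi1 phiM M.
move: (tw (word_pow X p)) (tw (word_inv (word_pow X p))) (tw M)
  (tw (word_inv M)) Sx => A A' B B' S BK; rewrite !mulmxA => rel.
have com : A *m B *m A' = B by rewrite -[LHS]mulmx1 -BK mulmxA rel mul1mx.
rewrite !mulmxDr !mulmxN !mulmxA rel com.
case: ifP => _; case: ifP => _; rewrite ?mulmx0 ?mulmx1 ?subr0 ?addr0 ?add0r //.
- by rewrite mulmxBl mul1mx [RHS]addrACA -addrA.
- by rewrite mulmxBl mul1mx.
- by rewrite oppr0 add0r.
Qed.

Lemma twist_fox_fibre (i : 'I_mu) j : (mu.-1 <= i)%N ->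
  dfox j (link_rel p q i) =
  (if gen_x mu == j then Sx else 0) - (if gen_y mu == j then Sy else 0).
Proof.
move=> ile; have rel := twist_word_rel alphaM phi1 i.
move: rel; rewrite /link_rel ltnNge ile /= => rel.
rewrite (twist_fox_cat alphaM phiM) (twist_fox_inv alphaM phi1 phiM).
rewrite !(twist_fox_pow alphaM phi1 phiM) !(twist_fox_gen alphaM phi1).
rewrite mulmxN !mulmxA -(twist_word_cat alphaM phiM (word_pow X p)) rel mul1mx.
by case: ifP => _; case: ifP => _; rewrite ?mulmx0 ?mulmx1.
Qed.

Definition diag_block j (s : 'I_mu) : 'M[ratfun]_n :=
  if (s < mu.-1)%N then
    if gen_m s == j then (1%:M - tw (word_gen (gen_m s))) *m Sx
    else tw (word_pow X p) - 1%:M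
  else if j == gen_y mu then Sx else - Sy.

Lemma det_link_minor j :
  \det (fox_minor alpha phi j) =
  (\prod_s \det (diag_block j s)) * \det (select_mx C mu n j (col_gen j)).
Proof.
rewrite (fox_minor_select alpha phi (@col_gen_inj j) (col_gen_neq j)) det_mulmx.
congr (_ * _).
have last_lt : (mu.-1 < mu)%N by rewrite prednK.
(* The relator matched with x; if x itself is deleted, the matrix is block
   diagonal and the last relator is an arbitrary choice. *)
pose c : 'I_mu := insubd (Ordinal last_lt) (val j).
have cE : c = (if (j < mu)%N then j : nat else mu.-1) :> nat.
  by rewrite val_insubd.
rewrite (det_mxblock_one_column (c := c)).
  apply: eq_bigr => s _; congr (\det _); rewrite /diag_block /col_gen.
  case: ifP => slt.
    rewrite twist_fox_meridian //; case: (gen_m s == j).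
      by rewrite eqxx gen_m_neq_x // addr0.
    by rewrite eqxx eq_sym gen_m_neq_x // add0r.
  rewrite twist_fox_fibre; last by rewrite leqNgt slt.
  case: (j == gen_y mu); rewrite eqxx; first by rewrite eq_sym gen_x_neq_y subr0.
  by rewrite gen_x_neq_y sub0r.
move=> i s; rewrite -!val_eqE /= cE => si sc.
have nx : (gen_x mu == col_gen j s) = false.
  apply/eqP => /(congr1 val) /=; rewrite gen_x_val col_gen_val.
  move: (ltn_ord j) (ltn_ord s) mu_gt0 sc.
  by do ?case: ifP => ?; lia.
have [ilt|ige] := ltnP i mu.-1.
  rewrite twist_fox_meridian // nx add0r ifF //.
  apply/eqP => /(congr1 val) /=; rewrite col_gen_val.
  move: (ltn_ord j) (ltn_ord s) mu_gt0 si.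
  by do ?case: ifP => ?; lia.
rewrite twist_fox_fibre // nx ifF ?subrr //.
apply/eqP => /(congr1 val) /=; rewrite col_gen_val.
move: (ltn_ord i) (ltn_ord j) (ltn_ord s) mu_gt0 si.
by do ?case: ifP => ?; lia.
Qed.

(** The factors of the minor once the block 1 - Phi(m_j), present when a
    meridian m_j is deleted, has been cancelled against the denominator
    det (Phi(m_j) - 1), leaving (-1)^n.  The image of the meridians no longer
    occurs: this is where the twisted polynomial stops depending on the
    continuous parameters of the representation. *)
Definition reduced_factor j (s : 'I_mu) : ratfun :=
  if (s < mu.-1)%N then
    if gen_m s == j then (-1) ^+ n * \det Sx
    else \det (tw (word_pow X p) - 1%:M)
  else \det (if j == gen_y mu then Sx else - Sy).

Definition reduced_denom (j : 'I_mu.+1) : ratfun :=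
  if (j < mu.-1)%N then 1 else wada_denom alpha phi j.

Lemma link_minor_ratio j : wada_denom alpha phi j != 0 ->
  \det (fox_minor alpha phi j) / wada_denom alpha phi j =
  (\prod_s reduced_factor j s) * \det (select_mx C mu n j (col_gen j)) /
  reduced_denom j.
Proof.
rewrite det_link_minor /reduced_denom => w0.
case: ifP => [jlt|jge]; last first.
  congr (_ * _ / _); apply: eq_bigr => s _.
  rewrite /diag_block /reduced_factor; case: ifP => slt //.
  have -> // : (gen_m s == j) = false.
  by apply/negP => /eqP e; rewrite -e /= slt in jge.
have jmu : (j < mu)%N by rewrite (leq_trans jlt) ?leq_pred.
pose i := Ordinal jmu; have ij : gen_m i = j by apply: val_inj.
have rest : \prod_(s | s != i) \det (diag_block j s) =
    \prod_(s | s != i) reduced_factor j s.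
  apply: eq_bigr => s si; rewrite /diag_block /reduced_factor.
  have -> : (gen_m s == j) = false by apply: negbTE; rewrite -val_eqE in si *.
  by case: ifP => //; case: ifP.
have at_i : \det (diag_block j i) =
    wada_denom alpha phi j * reduced_factor j i.
  rewrite /diag_block /reduced_factor /= jlt ij eqxx det_mulmx.
  rewrite -opprB -scaleN1r detZ -(wada_denomE (@alpha_linkM mu p q) phi1).
  by rewrite mulrCA mulrA.
rewrite (bigD1 i) //= [in RHS](bigD1 i) //= rest at_i divr1.
by apply: (canLR (mulfK w0)); rewrite [RHS]mulrC !mulrA.
Qed.

End OneRepresentation.

Lemma det_intertwine (F : fieldType) m (Q A A' : 'M[F]_m) :
  Q \in unitmx -> Q *m A = A' *m Q -> \det A = \det A'.
Proof.
rewrite unitmxE unitfE => Q0 /(congr1 determinant).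
by rewrite !det_mulmx mulrC => /(mulIf Q0).
Qed.

Lemma tconst_unitmx m (P : 'M[C]_m) :
  P \in unitmx -> map_mx (tconst mu) P \in unitmx.
Proof.
move=> uP; have := tconst_mxM mu P (invmx P).
by rewrite (mulmxV uP) tconst_mx1 => /esym/mulmx1_unit[uP' _]; exact: uP'.
Qed.

Section TwoRepresentations.
Variables phi phi' : link_group mu p q -> 'M[C]_n.
Hypothesis phi1 : phi 1%g = 1%:M.
Hypothesis phiM : forall g h, phi (g * h)%g = phi g *m phi h.
Hypothesis phi'1 : phi' 1%g = 1%:M.
Hypothesis phi'M : forall g h, phi' (g * h)%g = phi' g *m phi' h.
Let alphaM := @alpha_linkM mu p q.
Local Notation tw := (twist_word alpha phi).
Local Notation tw' := (twist_word alpha phi').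

Lemma twist_word_intertwine P w :
  P *m phi (pres_cls _ w) = phi' (pres_cls _ w) *m P ->
  map_mx (tconst mu) P *m tw w = tw' w *m map_mx (tconst mu) P.
Proof.
by move=> h; rewrite /twist_word -scalemxAr -scalemxAl -!tconst_mxM h.
Qed.

Lemma twist_pow_intertwine Q u m : Q *m tw u = tw' u *m Q ->
  Q *m tw (word_pow u m) = tw' (word_pow u m) *m Q.
Proof.
move=> h; elim: m => [|m IH].
  by rewrite (twist_word_nil alphaM phi1) (twist_word_nil alphaM phi'1) mulmx1 mul1mx.
rewrite [word_pow _ _]/(u ++ word_pow u m).
rewrite (twist_word_cat alphaM phiM) (twist_word_cat alphaM phi'M).
by rewrite mulmxA h -mulmxA IH mulmxA.
Qed.

Lemma geom_sum_intertwine Q u m : Q *m tw u = tw' u *m Q ->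
  Q *m geom_sum alpha phi u m = geom_sum alpha phi' u m *m Q.
Proof.
move=> h; rewrite mulmx_sumr mulmx_suml; apply: eq_bigr => i _.
exact: twist_pow_intertwine.
Qed.

(** The images of x and y may be conjugated by different matrices, since each
    determinant in [link_minor_ratio] involves only one of them. *)
Lemma twisted_alexander_similar P P' : (0 < p)%N -> (0 < q)%N ->
  P \in unitmx -> P' \in unitmx ->
  P *m phi (link_gen p q (gen_x mu)) = phi' (link_gen p q (gen_x mu)) *m P ->
  P' *m phi (link_gen p q (gen_y mu)) = phi' (link_gen p q (gen_y mu)) *m P' ->
  twisted_alexander alpha phi = twisted_alexander alpha phi'.
Proof.
move=> p0 q0 /tconst_unitmx uP /tconst_unitmx uP'.
move=> /twist_word_intertwine hx /twist_word_intertwine hy.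
have sub1 (Q A A' : 'M[ratfun]_n) : Q *m A = A' *m Q ->
    Q *m (A - 1%:M) = (A' - 1%:M) *m Q.
  by move=> h; rewrite mulmxBr mulmxBl h mulmx1 mul1mx.
have Sx : \det (geom_sum alpha phi X p) = \det (geom_sum alpha phi' X p).
  exact/(det_intertwine uP)/geom_sum_intertwine.
have Sy : \det (- geom_sum alpha phi Y q) = \det (- geom_sum alpha phi' Y q).
  apply: (det_intertwine uP'); rewrite mulmxN mulNmx; congr (- _).
  exact: geom_sum_intertwine.
have Xp : \det (tw (word_pow X p) - 1%:M) = \det (tw' (word_pow X p) - 1%:M).
  exact/(det_intertwine uP)/sub1/twist_pow_intertwine.
have factor j s : reduced_factor phi j s = reduced_factor phi' j s.
  rewrite /reduced_factor; case: (s < mu.-1)%N.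
    by case: (gen_m s == j); [exact: (congr1 _ Sx) | exact: Xp].
  by case: (j == gen_y mu); [exact: Sx | exact: Sy].
have denom j : reduced_denom phi j = reduced_denom phi' j.
  rewrite /reduced_denom; case: ltnP => [_|jge]; first by [].
  rewrite (wada_denomE alphaM phi1) (wada_denomE alphaM phi'1).
  have [->|->] : j = gen_x mu \/ j = gen_y mu; last first.
  - exact/(det_intertwine uP')/sub1.
  - exact/(det_intertwine uP)/sub1.
  case: (ltnP j mu) => h; [left|right]; apply: val_inj => /=;
    rewrite ?gen_x_val; move: (ltn_ord j); lia.
have w j : wada_denom alpha phi j != 0 by apply: link_denom_neq0.
have w' j : wada_denom alpha phi' j != 0 by apply: link_denom_neq0.
have ratio j : \det (fox_minor alpha phi j) / wada_denom alpha phi j =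
    \det (fox_minor alpha phi' j) / wada_denom alpha phi' j.
  apply: (etrans (link_minor_ratio phi1 phiM (w j))).
  apply: (etrans _ (esym (link_minor_ratio phi'1 phi'M (w' j)))).
  apply: (f_equal2 (fun u v => u * _ / v)); last exact: denom.
  by apply: eq_bigr => s _; apply: factor.
apply/seteqP; split=> f [j [e [b [_ be fE]]]]; exists j, e, b.
  by split; [exact: w' | exact: be | apply: (etrans fE (congr1 _ (ratio j)))].
split; [exact: w | exact: be | exact: (etrans fE (congr1 _ (esym (ratio j))))].
Qed.

End TwoRepresentations.
End LinkMinors.

(** * Rigidity of matrices of finite order *)

Section FiniteOrder.
Variable R : pzRingType.

(** When x^N = y^N = 1 this is [N] times the average of y^i x^-i over the cyclic
    group of order [N], with x^-i written as x^(N - i) to avoid inverses. *)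
Definition averaging (x y : R) (N : nat) : R := \sum_(i < N) y ^+ i * x ^+ (N - i).

Lemma averaging_intertwine x y N : x ^+ N = 1 -> y ^+ N = 1 ->
  averaging x y N * x = y * averaging x y N.
Proof.
case: N => [|N xN yN]; first by rewrite /averaging !big_ord0 mul0r mulr0.
rewrite /averaging mulr_suml mulr_sumr big_ord_recl [RHS]big_ord_recr /=.
rewrite expr0 mul1r subn0 xN mulrA -exprS yN subSnn !mul1r addrC; congr (_ + _).
apply: eq_bigr => i _; rewrite /= mulrA -exprS -mulrA -exprSr; congr (_ * _ ^+ _).
by rewrite /bump /= add1n subSS subSn // ltnW.
Qed.

Lemma averaging_self x N : x ^+ N = 1 -> averaging x x N = N%:R.
Proof.
move=> xN; rewrite /averaging (eq_bigr (fun=> 1)) ?sumr_const ?card_ord // => i _.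
by rewrite -exprD subnKC // ltnW.
Qed.

End FiniteOrder.

Section Similarity.
Variables (C : fieldType) (d : nat).

Definition similar_mx (A B : 'M[C]_d) : Prop :=
  exists2 P, P \in unitmx & P *m A = B *m P.

Lemma similar_mx_sym A B : similar_mx A B -> similar_mx B A.
Proof.
case=> P uP h; exists (invmx P); first by rewrite unitmx_inv.
by apply: (can_inj (mulmxK uP)); rewrite -!mulmxA -h mulKmx // mulVmx // mulmx1.
Qed.

Lemma similar_mx_trans A B D : similar_mx A B -> similar_mx B D -> similar_mx A D.
Proof.
case=> P uP hP [Q uQ hQ]; exists (Q *m P); first by rewrite unitmx_mul uQ.
by rewrite -mulmxA hP mulmxA hQ mulmxA.
Qed.

End Similarity.

Section NearbyFiniteOrder.
Variables (R : realType) (T : topologicalType) (d : nat).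
Local Notation C := (Cplx R).

(** Coordinatewise continuity suffices for determinants, and it is stable under
    products by the formula for their entries. *)
Definition entries_continuous (f : T -> 'M[C]_d.+1) : Prop :=
  forall i j, continuous (fun t => f t i j).

Lemma continuous_bigsum (I : Type) (s : seq I) (F : I -> T -> C) :
  (forall i, continuous (F i)) -> continuous (fun t => \sum_(i <- s) F i t).
Proof.
move=> Fc; elim: s => [|a s IH] t.
  by under eq_fun do rewrite big_nil; apply: cst_continuous.
by under eq_fun do rewrite big_cons; apply: continuousD; [apply: Fc|apply: IH].
Qed.

Lemma continuous_bigprod (I : Type) (s : seq I) (F : I -> T -> C) :
  (forall i, continuous (F i)) -> continuous (fun t => \prod_(i <- s) F i t).
Proof.
move=> Fc; elim: s => [|a s IH] t.
  by under eq_fun do rewrite big_nil; apply: cst_continuous.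
by under eq_fun do rewrite big_cons; apply: continuousM; [apply: Fc|apply: IH].
Qed.

Lemma entries_continuousM f g : entries_continuous f -> entries_continuous g ->
  entries_continuous (fun t => f t * g t).
Proof.
move=> fc gc i j; under eq_fun do rewrite mxE.
by apply: continuous_bigsum => k t; apply: continuousM; [apply: fc|apply: gc].
Qed.

Lemma entries_continuous_cst A : entries_continuous (fun=> A).
Proof. by move=> i j; apply: cst_continuous. Qed.

Lemma entries_continuousX f m : entries_continuous f ->
  entries_continuous (fun t => f t ^+ m).
Proof.
move=> fc; elim: m => [|m IH]; first exact: entries_continuous_cst.
by under eq_fun do rewrite exprS; apply: entries_continuousM.
Qed.

Lemma entries_continuous_averaging X f N : entries_continuous f ->
  entries_continuous (fun t => averaging X (f t) N).
Proof.
move=> fc i j; under eq_fun do rewrite summxE.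
apply: continuous_bigsum => k.
apply: entries_continuousM; last exact: entries_continuous_cst.
exact: entries_continuousX.
Qed.

Lemma det_continuous f : entries_continuous f -> continuous (fun t => \det (f t)).
Proof.
move=> fc; apply: continuous_bigsum => s t.
apply: (@continuousM C T (fun=> (-1) ^+ s) (fun u => \prod_i f u i (s i))).
  exact: cst_continuous.
by apply: continuous_bigprod => i; apply: fc.
Qed.

(** Matrices of fixed finite order are rigid: [averaging] intertwines two of
    them and equals the scalar [N] when they coincide, so it is still invertible
    when they are close. *)
Lemma near_similar f N t0 : (0 < N)%N -> entries_continuous f ->
  (forall t, f t ^+ N = 1) -> \forall t \near t0, similar_mx (f t0) (f t).
Proof.
move=> N0 fc fN.
have near_unit : \forall t \near t0, \det (averaging (f t0) (f t) N) != 0.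
  apply: (cvgr_neq0 (\det (averaging (f t0) (f t0) N))).
    exact: (@det_continuous _ (@entries_continuous_averaging (f t0) f N fc) t0).
  rewrite averaging_self // -(rmorph_nat (@scalar_mx C d.+1)) det_scalar.
  by rewrite expf_neq0 // pnatr_eq0 -lt0n.
near=> t; exists (averaging (f t0) (f t) N).
  by rewrite unitmxE unitfE; near: t.
exact: averaging_intertwine.
Unshelve. all: by end_near.
Qed.

End NearbyFiniteOrder.

(** * The central element of the link group *)

Section Schur.
Variables (C : closedFieldType) (G : groupType) (n : nat) (phi : G -> 'M[C]_n.+1).

(** Schur's lemma: an eigenspace of [A] is invariant and nonzero. *)
Lemma irreducible_scalar (A : 'M[C]_n.+1) : irreducible_rep phi ->
  (forall g, phi g *m A = A *m phi g) -> exists a, A = a%:M.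
Proof.
move=> irr comA.
have /closed_rootP[a] : size (char_poly A^T) != 1%N by rewrite size_char_poly.
rewrite -eigenvalue_root_char => /eigenvalueP[v vA v0]; exists a.
pose f : 'Hom('cV[C]_n.+1, 'cV[C]_n.+1) := linfun (mulmx (A - a%:M)).
have fE u : f u = A *m u - a *: u by rewrite lfunE /= mulmxBl mul_scalar_mx.
have [|ker0|kerT] := irr (lker f).
- move=> g u; rewrite !memv_ker !fE => /eqP Au.
  by rewrite mulmxA -comA -mulmxA scalemxAr -mulmxBr Au mulmx0.
- have : v^T \in lker f.
    rewrite memv_ker fE -[A]trmxK -trmx_mul vA; apply/eqP.
    by apply/matrixP => i j; rewrite !mxE subrr.
  by rewrite ker0 memv0 -trmx0 (inj_eq trmx_inj) (negbTE v0).
apply/eqP; rewrite -subr_eq0; apply/eqP/matrixP => i j.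
have : delta_mx j 0 \in lker f by rewrite kerT memvf.
by rewrite memv_ker lfunE /= -colE => /eqP/matrixP/(_ i 0); rewrite !mxE.
Qed.

End Schur.

Lemma comm_of_relator (R : pzRingType) (a b a' b' : R) :
  a' * a = 1 -> b' * b = 1 -> a * b * a' * b' = 1 -> GRing.comm a b.
Proof.
move=> VA VB rel; rewrite /GRing.comm -[LHS]mulr1 -VA mulrA; congr (_ * _).
by rewrite -[LHS]mulr1 -VB mulrA rel mul1r.
Qed.

Section CentralFibre.
Variables (C : closedFieldType) (mu p q : nat).
Hypothesis mu_gt0 : (0 < mu)%N.
Variable rho : link_group mu p q -> 'M[C]_2.
Hypothesis rep : SL_rep rho.
Local Notation M w := (rho (pres_cls (link_rel p q) w)).
Local Notation x := (rho (link_gen p q (gen_x mu))).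
Local Notation y := (rho (link_gen p q (gen_y mu))).

Let rho1 : M [::] = 1. Proof. by case: rep. Qed.
Let rhoM u v : M (u ++ v) = M u * M v.
Proof. by case: rep => _ _ h; rewrite pres_cls_cat; apply: h. Qed.

Let rho_pow w m : M (word_pow w m) = M w ^+ m.
Proof.
elim: m => [|m IH]; first exact: rho1.
by rewrite [word_pow _ _]/(w ++ word_pow w m) rhoM IH exprS.
Qed.

Let rhoV w : M w * M (word_inv w) = 1.
Proof. by rewrite -rhoM -rho1; congr rho; apply/pres_clsP/pres_eqwV. Qed.

Let rhoVl w : M (word_inv w) * M w = 1.
Proof. by rewrite -rhoM -rho1; congr rho; apply/pres_clsP/pres_eqVw. Qed.

Let rho_rel i : M (link_rel p q i) = 1.
Proof.
rewrite -rho1; congr rho; apply/pres_clsP.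
by have := PresRel (link_rel p q) [::] i [::]; rewrite cats0.
Qed.

Lemma fibre_pow_eq : x ^+ p = y ^+ q.
Proof.
have last_lt : (mu.-1 < mu)%N by rewrite prednK.
have := rho_rel (Ordinal last_lt); rewrite /link_rel ltnn rhoM => e.
rewrite -[LHS]mulr1 -(rhoVl (word_pow (word_gen (gen_y mu)) q)) mulrA.
by rewrite -!rho_pow e mul1r.
Qed.

Lemma fibre_comm_gen i : GRing.comm (x ^+ p) (rho (link_gen p q i)).
Proof.
have [ilt|ige] := ltnP i mu.-1.
  have imu : (i < mu)%N by rewrite (leq_trans ilt) ?leq_pred.
  have ei : gen_m (Ordinal imu) = i by apply: val_inj.
  have := rho_rel (Ordinal imu); rewrite /link_rel /= ilt /word_comm !rhoM ei.
  rewrite !mulrA rho_pow => rel.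
  have VA := rhoVl (word_pow (word_gen (gen_x mu)) p); rewrite rho_pow in VA.
  exact: (comm_of_relator VA (rhoVl (word_gen i)) rel).
have [->|->] : i = gen_x mu \/ i = gen_y mu.
- case: (ltnP i mu) => h; [left|right]; apply: val_inj => /=;
    rewrite ?gen_x_val; move: (ltn_ord i); lia.
- exact/commr_sym/commrX.
- by rewrite fibre_pow_eq; exact/commr_sym/commrX.
Qed.

Lemma fibre_comm g : GRing.comm (x ^+ p) (rho g).
Proof.
rewrite -(pres_cls_repr g); elim: (repr g) => [|[i b] w IH].
  by rewrite rho1; apply: commr1.
rewrite -cat1s rhoM; apply: commrM => //.
have ci := fibre_comm_gen i; case: b => //.
have V := rhoV (word_gen i); have V' := rhoVl (word_gen i).
rewrite /GRing.comm -[LHS]mul1r -V' -!mulrA; congr (_ * _).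
by rewrite mulrA -ci -mulrA V mulr1.
Qed.

(** The class x^p is central, hence acts as a scalar, whose square is its
    determinant 1. *)
Lemma fibre_pow_order : irreducible_rep rho -> x ^+ (p * 2) = 1.
Proof.
move=> irr; have [g|a e] := irreducible_scalar irr (A := x ^+ p).
  exact/esym/fibre_comm.
rewrite exprM e expr2 -mulmxE -scalar_mxM; congr _%:M.
have [detx _ _] := rep; move: (detx (pres_cls _ (word_pow (word_gen (gen_x mu)) p))).
by rewrite rho_pow e det_scalar expr2.
Qed.

End CentralFibre.

(** * Local constancy on the character variety *)

Section SymmetricPowerTwist.
Variables (C : fieldType) (mu p q n : nat).
Hypotheses (mu_gt0 : (0 < mu)%N) (p_gt0 : (0 < p)%N) (q_gt0 : (0 < q)%N).
Hypothesis n_gt0 : (0 < n)%N.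
Local Notation x := (link_gen p q (gen_x mu)).
Local Notation y := (link_gen p q (gen_y mu)).

Lemma sigma_unitmx (P : 'M[C]_2) : P \in unitmx -> sigma n P \in unitmx.
Proof.
move=> uP; have uV : invmx P \in unitmx by rewrite unitmx_inv.
have := sigma_mul n_gt0 uP uV; rewrite (mulmxV uP) sigma_one.
by move=> /esym/mulmx1_unit[us _]; exact: us.
Qed.

Lemma sigma_intertwine (P A B : 'M[C]_2) :
  P \in unitmx -> A \in unitmx -> B \in unitmx -> P *m A = B *m P ->
  sigma n P *m sigma n A = sigma n B *m sigma n P.
Proof.
move=> uP uA uB /(congr1 (sigma n)) h.
exact: etrans (esym (sigma_mul n_gt0 uP uA)) (etrans h (sigma_mul n_gt0 uB uP)).
Qed.

Lemma sigma_twisted_alexander_similar (rho rho' : link_group mu p q -> 'M[C]_2) :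
  SL_rep rho -> SL_rep rho' ->
  similar_mx (rho x) (rho' x) -> similar_mx (rho y) (rho' y) ->
  twisted_alexander (@alpha_link mu p q) (fun g => sigma n (rho g)) =
  twisted_alexander (@alpha_link mu p q) (fun g => sigma n (rho' g)).
Proof.
move=> [d1 one1 mul1] [d2 one2 mul2] [P uP hP] [Q uQ hQ].
have u1 g : rho g \in unitmx by rewrite unitmxE d1 unitr1.
have u2 g : rho' g \in unitmx by rewrite unitmxE d2 unitr1.
apply: (twisted_alexander_similar mu_gt0 _ _ _ _ p_gt0 q_gt0
  (sigma_unitmx uP) (sigma_unitmx uQ)).
- by rewrite one1 sigma_one.
- by move=> g h; rewrite mul1 (sigma_mul n_gt0 (u1 g) (u1 h)).
- by rewrite one2 sigma_one.
- by move=> g h; rewrite mul2 (sigma_mul n_gt0 (u2 g) (u2 h)).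
- exact: (sigma_intertwine uP (u1 x) (u2 x) hP).
- exact: (sigma_intertwine uQ (u1 y) (u2 y) hQ).
Qed.

End SymmetricPowerTwist.

Section Representations.
Variables (R : realType) (mu p q n : nat).
Hypotheses (mu_gt0 : (0 < mu)%N) (p_gt0 : (0 < p)%N) (q_gt0 : (0 < q)%N).
Hypothesis n_gt0 : (0 < n)%N.
Local Notation C := (Cplx R).
Local Notation x := (link_gen p q (gen_x mu)).
Local Notation y := (link_gen p q (gen_y mu)).

Lemma irrepP (rho : irrep R mu p q) :
  SL_rep (irrep_fun rho) /\ irreducible_rep (irrep_fun rho).
Proof. exact/asboolP/(svalP rho). Qed.

Lemma irrep_twisted_alexander (rho rho' : irrep R mu p q) :
  similar_mx (irrep_fun rho x) (irrep_fun rho' x) ->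
  similar_mx (irrep_fun rho y) (irrep_fun rho' y) ->
  link_twisted_alexander n rho = link_twisted_alexander n rho'.
Proof.
have [rep _] := irrepP rho; have [rep' _] := irrepP rho'.
exact: sigma_twisted_alexander_similar.
Qed.

Lemma irrep_gen_continuous (i : 'I_mu.+1) (a b : 'I_2) :
  continuous (fun rho : irrep R mu p q => irrep_fun rho (link_gen p q i) a b).
Proof.
move=> rho.
have c1 : {for rho, continuous (@irrep_coord R mu p q : irrep R mu p q -> _)}.
  exact: initial_continuous.
have c2 := @proj_continuous _ (fun _ : 'I_mu.+1 => 'M[C]_2) i (irrep_coord rho).
have c3 := @coord_continuous C 2 2 a b (irrep_fun rho (link_gen p q i)).
exact: (continuous_comp (continuous_comp c1 c2) c3).
Qed.

Lemma irrep_x_order (rho : irrep R mu p q) : irrep_fun rho x ^+ (p * 2) = 1.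
Proof. by have [rep irr] := irrepP rho; apply: fibre_pow_order. Qed.

Lemma irrep_y_order (rho : irrep R mu p q) : irrep_fun rho y ^+ (q * 2) = 1.
Proof.
have [rep irr] := irrepP rho.
by rewrite exprM -(fibre_pow_eq mu_gt0 rep) -exprM irrep_x_order.
Qed.

(** The images of x and y are compared separately, with no common conjugating
    matrix: the classes of this relation are unions of conjugacy classes and,
    by rigidity, they are open. *)
Definition same_type (rho rho' : irrep R mu p q) : Prop :=
  similar_mx (irrep_fun rho x) (irrep_fun rho' x) /\
  similar_mx (irrep_fun rho y) (irrep_fun rho' y).

Lemma same_type_near (rho : irrep R mu p q) :
  \forall rho' \near rho, same_type rho rho'.
Proof.
apply: filterI.
- apply: (@near_similar R _ 1 (fun r => irrep_fun r x) (p * 2)%N).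
  + by rewrite muln_gt0 p_gt0.
  + by move=> a b; apply: irrep_gen_continuous.
  + exact: irrep_x_order.
- apply: (@near_similar R _ 1 (fun r => irrep_fun r y) (q * 2)%N).
  + by rewrite muln_gt0 q_gt0.
  + by move=> a b; apply: irrep_gen_continuous.
  + exact: irrep_y_order.
Qed.

Lemma same_type_trans r1 r2 r3 :
  same_type r1 r2 -> same_type r2 r3 -> same_type r1 r3.
Proof. by move=> [h1 h2] [h3 h4]; split; apply: similar_mx_trans; eassumption. Qed.

Lemma same_type_sym r1 r2 : same_type r1 r2 -> same_type r2 r1.
Proof. by move=> [h1 h2]; split; apply: similar_mx_sym. Qed.

Lemma same_type_conj r1 r2 : irrep_conj r1 r2 -> same_type r1 r2.
Proof.
case=> P dP h; have uP : P \in unitmx by rewrite unitmxE dP unitr1.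
by split; exists P => //; rewrite h mulmxKV.
Qed.

Lemma same_type_repr (rho : irrep R mu p q) :
  same_type (repr (char_cls rho)) rho.
Proof.
apply: same_type_conj; apply/asboolP.
have : char_cls (repr (char_cls rho)) = char_cls rho by rewrite /char_cls reprK.
by move=> /eqmodP.
Qed.

End Representations.

Theorem corollary5p2 (R : realType) (mu p q n : nat)
  (hmu : (1 <= mu)%N) (hp : (0 < p)%N) (hq : (0 < q)%N) (hpq : coprime p q)
  (hn : (1 <= n)%N) (c : char_variety R mu p q) :
  exists2 U : set (char_variety R mu p q), nbhs c U &
    forall rho rho' : irrep R mu p q,
      U (char_cls rho) -> U (char_cls rho') ->
      link_twisted_alexander n rho = link_twisted_alexander n rho'.
Proof.
pose U : set (char_variety R mu p q) := [set c' | same_type (repr c) (repr c')].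
exists U.
  apply: open_nbhs_nbhs; split; last first.
    by rewrite /U /= -{2}(reprK c); apply/same_type_sym/same_type_repr.
  rewrite /open /= /quotient_open openE => rho Urho.
  rewrite /interior; near=> rho'.
  apply: (same_type_trans Urho).
  apply: (same_type_trans (same_type_repr rho)).
  apply: same_type_trans (same_type_sym (same_type_repr rho')).
  by near: rho'; apply: same_type_near.
move=> rho rho' Ur Ur'.
have [] := same_type_trans (same_type_sym (same_type_trans Ur (same_type_repr rho)))
  (same_type_trans Ur' (same_type_repr rho')).
exact: irrep_twisted_alexander.
Unshelve. all: by end_near.
Qed.
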